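(* (a) Let $(X,D)$ be a locally compact, complete metric space, let $\alpha>1$, and let $\Omega\subseteq X$ be an open set such that $\mathcal D_\alpha(\Omega)\neq\varnothing$. Then for all $(d_n)_{n\in\mathbb N}\subseteq\mathcal D_\alpha(\Omega)$ and $d\in\mathcal D_\alpha(\Omega)$ the implication $$d_n\to d\ \text{ in }\mathcal D_\alpha(\Omega)\quad\Longrightarrow\quad L_{d_n}\xrightarrow{\Gamma}L_d\ \text{ in }\mathrm{Lip}([0,1];\Omega)$$ holds. (b) The converse implication fails in general: there exist a locally compact, complete metric space $(X,D)$, a constant $\alpha>1$, an open set $\Omega\subseteq X$ with $\mathcal D_\alpha(\Omega)\ne\varnothing$, a sequence $(d_n)_{n\in\mathbb N}\subseteq\mathcal D_\alpha(\Omega)$ and $d\in\mathcal D_\alpha(\Omega)$ such that $L_{d_n}\xrightarrow{\Gamma}L_d$ in $\mathrm{Lip}([0,1];\Omega)$ but $d_n$ does not converge to $d$ in $\mathcal D_\alpha(\Omega)$.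
   Context: Length: for a metric space $(E,\rho)$ and a continuous curve $\gamma\colon[a,b]\to E$, $L_\rho(\gamma):=\sup\{\sum_{i=1}^k\rho(\gamma_{t_i},\gamma_{t_{i-1}}) : k\in\mathbb N,\ a=t_0<t_1<\dots<t_k=b\}\in[0,+\infty]$. $(E,\rho)$ is a length space if $\rho(x,y)=\inf\{L_\rho(\gamma) : \gamma\colon[0,1]\to E \text{ Lipschitz},\ \gamma_0=x,\ \gamma_1=y\}$ for all $x,y\in E$. The class $\mathcal D_\alpha(\Omega)$: the set of all distances $d$ on $\Omega$ such that $(\Omega,d)$ is a length space and $\alpha^{-1}D(x,y)\le d(x,y)\le\alpha D(x,y)$ for all $x,y\in\Omega$. It is endowed with the topology of uniform convergence on compact subsets of $\Omega\times\Omega$. $\mathrm{Lip}([0,1];\Omega)$ is the set of Lipschitz curves from $[0,1]$ to $(\Omega,D)$ (equivalently, to $(\Omega,d)$ for any $d\in\mathcal D_\alpha(\Omega)$), with the topology of uniform convergence. The functionals $L_{d_n}$, $L_d$ are restricted to this space. $\Gamma$-convergence: functionals $G_n\colon T\to[0,+\infty]$ on a topological space $T$ $\Gamma$-converge to $G\colon T\to[0,+\infty]$, written $G_n\xrightarrow{\Gamma}G$, if for every $x\in T$: $G(x)\le\liminf_n G_n(x_n)$ for every sequence $x_n\to x$ in $T$; and there is a sequence $x_n\to x$ in $T$ with $\limsup_n G_n(x_n)\le G(x)$. *)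

(* Defs.v *)
From mathcomp Require Import all_boot all_order all_algebra.
From mathcomp Require Import all_classical all_reals all_analysis.

Set Implicit Arguments.
Unset Strict Implicit.
Unset Printing Implicit Defensive.

Import Order.TTheory GRing.Theory Num.Theory.
Import numFieldTopology.Exports.

Local Open Scope classical_set_scope.
Local Open Scope ring_scope.

(* The axiom of the library's completeType, which in addition demands a
   distinguished point and so would exclude the empty space. *)
Definition complete_space (X : uniformType) : Prop :=
  forall F : set_system X, ProperFilter F -> cauchy F -> exists x : X, F --> x.

Section MetricNotions.
Context {R : realType} {E : Type}.
Implicit Types (rho : E * E -> R).

Definition distance rho : Prop :=
  [/\ forall x y, 0 <= rho (x, y),
      forall x y, rho (x, y) = 0 <-> x = y,
      forall x y, rho (x, y) = rho (y, x)
    & forall x y z, rho (x, z) <= rho (x, y) + rho (y, z)].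

Definition curve_length rho (a b : R) (g : `[a, b]%classic -> E) : \bar R :=
  ereal_sup [set s | exists (k : nat) (t : nat -> `[a, b]%classic),
    [/\ \val (t 0%N) = a, \val (t k) = b,
        forall i : nat, (i < k)%N -> \val (t i) < \val (t i.+1)
      & s = (\sum_(1 <= i < k.+1) rho (g (t i), g (t i.-1)))%:E]].

Definition lipschitz_curve rho (a b : R) (g : `[a, b]%classic -> E) : Prop :=
  exists k : R, forall s t, rho (g s, g t) <= k * `|\val s - \val t|.

Definition length_space rho : Prop :=
  distance rho /\
  forall x y : E, (rho (x, y))%:E =
    ereal_inf [set curve_length rho g | g in
      [set g : `[0%R : R, 1%R]%classic -> E |
        [/\ lipschitz_curve rho g,
            forall t, \val t = 0 -> g t = x
          & forall t, \val t = 1 -> g t = y]]].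

End MetricNotions.

Definition restr_mdist {R : realType} {X : metricType R} (Omega : set X)
  (p : Omega * Omega) : R := mdist (\val p.1) (\val p.2).

(* The carriers below are sets in a function space with the desired topology,
   so their coercions to types carry the subspace topology. *)
Definition Dclass {R : realType} {X : metricType R} (alpha : R)
    (Omega : set X) : set {family compact, (Omega * Omega)%type -> R} :=
  [set d | length_space d /\ forall p : Omega * Omega,
     alpha^-1 * restr_mdist p <= d p <= alpha * restr_mdist p].
Arguments Dclass {R X} alpha Omega _.

Definition Lip01 {R : realType} {X : metricType R} (Omega : set X) :
    set {uniform `[0%R : R, 1%R]%classic -> Omega} :=
  [set g | lipschitz_curve (@restr_mdist R X Omega) g].
Arguments Lip01 {R X} Omega _.

Definition Lip_length {R : realType} {X : metricType R} (alpha : R)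
    (Omega : set X) (d : Dclass alpha Omega) (g : Lip01 Omega) : \bar R :=
  curve_length (\val d) (\val g).

Definition gamma_cvg {R : realType} {T : topologicalType}
    (G_ : nat -> T -> \bar R) (G : T -> \bar R) : Prop :=
  forall x : T,
    (forall x_ : nat -> T, x_ @ \oo --> x ->
       (G x <= limn_einf (fun n => G_ n (x_ n)))%E) /\
    (exists2 x_ : nat -> T, x_ @ \oo --> x &
       (limn_esup (fun n => G_ n (x_ n)) <= G x)%E).

(* Main.v *)
Require Import Defs.
From HB Require Import structures.
From mathcomp Require Import all_boot all_order all_algebra.
From mathcomp Require Import all_classical all_reals all_analysis.
From mathcomp Require Import ring lra.

Set Implicit Arguments.
Unset Strict Implicit.
Unset Printing Implicit Defensive.

Import Order.TTheory GRing.Theory Num.Theory.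
Import numFieldTopology.Exports.

Local Open Scope classical_set_scope.
Local Open Scope ring_scope.

(** Lengths are handled through arc-length functions.  A curve [h] has length
    at most [M] exactly when some real function [phi], growing by at most [M],
    satisfies [rho (h s, h t) <= phi t - phi s] for [s <= t] ([controlled],
    [curve_length_le], [length_controlled]): the inequality telescopes along
    any partition, and conversely the supremum of the partition sums up to
    time [t] is such a function.  Being Lipschitz is the same condition with
    [phi] linear.  In this form concatenating curves means gluing real
    functions, and no partition ever has to be refined.

    Convergence implies Gamma-convergence, and pointwise convergence of the
    distances is enough for it ([gamma_cvg_of_pointwise]).  All distances of
    the class are dominated by the same multiple of [D], so [d_n] converges
    along converging pairs of points; every partition sum therefore passes to
    the limit, and the length, a supremum of such sums, satisfies the liminf
    inequality ([length_liminf]).  For a recovery sequence at a curve [g], cut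
    [0, 1] into [N] equal pieces and join the successive nodes of [g] by almost
    shortest curves for [d_n] ([polygon_approx]).  The resulting polygon has
    [d_n]-length close to the sum of the [d_n]-distances between nodes; when
    [n] grows this sum tends to the corresponding sum for [d], which is at most
    the length of [g].  The polygon stays close to [g] for large [N], uniformly in
    [n], because every piece starts on [g] and is short
    ([recovery_curves]).  A diagonal choice of [N] finishes the argument.

    The converse fails because shortcuts can escape to the boundary of the
    domain.  In the open upper half-plane, let horizontal motion cost 2 per
    unit, vertical motion cost 1, and let [d_n] halve the horizontal cost below
    height [1/(n+1)].  A curve in the half-plane keeps a positive distance from
    the boundary, so curves uniformly close to it do not feel the cheap strip
    once [n] is large, and the lengths Gamma-converge to the one without any
    strip ([gamma_cvg_short]).  Distances do feel it: going down to the strip,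
    across and up again beats the straight route between far apart points
    ([short_not_cvg]).  The length distance with a cheap strip has a closed
    form, [short], the cheaper of the two routes, which makes the example
    explicit. *)

(** * Lengths and arc-length functions *)

Section Control.
Context {R : realType} {E : Type}.
Implicit Types (rho : E * E -> R) (h : R -> E) (phi psi : R -> R).

(** Curves are functions on the whole line here, looked at on [[a, b]] only, so
    that shifting, rescaling and gluing need no dependent types. *)
Definition controlled rho (a b : R) h phi :=
  forall s t, a <= s -> s <= t -> t <= b -> rho (h s, h t) <= phi t - phi s.

Lemma controlledW rho a b h phi psi :
  (forall s t, a <= s -> s <= t -> t <= b -> phi t - phi s <= psi t - psi s) ->
  controlled rho a b h phi -> controlled rho a b h psi.
Proof.
move=> le_phi ctl s t as_ st tb.
exact: le_trans (ctl _ _ as_ st tb) (le_phi _ _ as_ st tb).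
Qed.

Lemma controlled_affine rho a b a' b' c e h phi :
  0 <= c -> a <= c * a' + e -> c * b' + e <= b ->
  controlled rho a b h phi ->
  controlled rho a' b' (fun t => h (c * t + e)) (fun t => phi (c * t + e)).
Proof.
move=> c0 le_a le_b ctl s t as_ st tb; apply: ctl.
- by apply: le_trans le_a _; rewrite lerD2r ler_wpM2l.
- by rewrite lerD2r ler_wpM2l.
- by apply: le_trans le_b; rewrite lerD2r ler_wpM2l.
Qed.

Definition glue {T : Type} (b : R) (f1 f2 : R -> T) (t : R) : T :=
  if t <= b then f1 t else f2 t.

Lemma glue_r {T : Type} b (f1 f2 : R -> T) t :
  f1 b = f2 b -> b <= t -> glue b f1 f2 t = f2 t.
Proof.
move=> fb bt; rewrite /glue; case: ifPn => // tb.
have /eqP -> : t == b by rewrite eq_le tb.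
by [].
Qed.

(** For [s] and [t] on both sides of the junction, pass through the common
    point [h1 b = h2 b] and use the triangle inequality. *)
Lemma controlled_glue rho a b c h1 h2 phi1 phi2 : distance rho ->
  h1 b = h2 b -> phi1 b = phi2 b ->
  controlled rho a b h1 phi1 -> controlled rho b c h2 phi2 ->
  controlled rho a c (glue b h1 h2) (glue b phi1 phi2).
Proof.
move=> [_ _ _ tri] hb phib ctl1 ctl2 s t as_ st tc.
have [tb|/ltW bt] := leP t b.
  by rewrite /glue tb (le_trans st tb); exact: ctl1.
rewrite !(glue_r _ bt)//; have [sb|/ltW bs] := leP s b; last first.
  by rewrite !(glue_r _ bs)//; exact: ctl2.
rewrite /glue sb; apply: le_trans (tri _ (h1 b) _) _.
have := ctl1 s b as_ sb (lexx _); rewrite {2}hb => le1.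
have := ctl2 b t (lexx _) bt tc; rewrite -phib => le2.
by rewrite hb in le1 *; lra.
Qed.

(** The retraction of the line onto the unit interval: composing with it turns a
    curve on the interval into a function on the line. *)
Definition unit_clamp (t : R) : `[0 : R, 1]%classic.
Proof.
exists (Num.max 0 (Num.min t 1)).
by rewrite inE /= in_itv /= le_max lexx ge_max ler01 ge_min lexx orbT.
Defined.

Lemma unit_clampE t : 0 <= t -> t <= 1 -> \val (unit_clamp t) = t.
Proof. by move=> t0 t1; rewrite /= min_l// max_r. Qed.

Lemma unitP (t : `[0 : R, 1]%classic) : 0 <= \val t /\ \val t <= 1.
Proof. by case: t => t /=; rewrite inE /= in_itv /= => /andP[]. Qed.

Lemma unit_clampK (t : `[0 : R, 1]%classic) : unit_clamp (\val t) = t.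
Proof. by apply: val_inj; have [] := unitP t; exact: unit_clampE. Qed.

Lemma unit_clamp_lipschitz (s t : R) :
  `|\val (unit_clamp s) - \val (unit_clamp t)| <= `|s - t|.
Proof.
wlog st : s t / s <= t.
  by move=> W; have [/W//|/ltW/W] := leP s t; rewrite distrC [leRHS]distrC.
rewrite [leRHS]distrC [leRHS]ger0_norm ?subr_ge0//= ler_norml.
case: (leP s 1) => s1; case: (leP t 1) => t1;
  rewrite /Num.max; do ![case: ifPn; rewrite -?leNgt => ?];
  by apply/andP; split; lra.
Qed.

(** Each partition sum is bounded term by term by a telescoping sum. *)
Lemma curve_length_le rho (g : `[0 : R, 1]%classic -> E) phi :
  distance rho ->
  controlled rho 0 1 (g \o unit_clamp) phi ->
  (curve_length rho g <= (phi 1 - phi 0)%:E)%E.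
Proof.
move=> [_ _ sym _] ctl; apply: ge_ereal_sup => _ [k [t [t0 tk incr ->]]].
have -> : phi 1 - phi 0 =
    \sum_(0 <= i < k) (phi (\val (t i.+1)) - phi (\val (t i))).
  by rewrite (telescope_sumr (fun i => phi (\val (t i))))// t0 tk.
rewrite lee_fin big_add1 !big_mkord; apply: ler_sum => i _ /=; rewrite sym.
have /= := ctl (\val (t i)) (\val (t i.+1)); rewrite !unit_clampK.
by apply; [exact: (unitP _).1| exact/ltW/incr | exact: (unitP _).2].
Qed.

(** The function is [t |-> sup (S t)], with [S t] the set of sums over partitions
    of [[0, t]].  Appending [t] to a partition of [[0, s]] gives one of [[0, t]],
    which is the required inequality; only this superadditivity of the length
    is used. *)
Lemma length_controlled rho (g : `[0 : R, 1]%classic -> E) M :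
  distance rho -> (curve_length rho g <= M%:E)%E ->
  exists2 phi, controlled rho 0 1 (g \o unit_clamp) phi & phi 1 - phi 0 <= M.
Proof.
move=> [rho0 rhoxx sym _] leM.
pose S u := [set s : R | exists (k : nat) (t : nat -> `[0 : R, 1]%classic),
  [/\ \val (t 0%N) = 0, \val (t k) = u,
      forall i : nat, (i < k)%N -> \val (t i) < \val (t i.+1)
    & s = \sum_(1 <= i < k.+1) rho (g (t i), g (t i.-1))]].
have S_app u v x : S u x -> 0 <= u -> u < v -> v <= 1 ->
    S v (x + rho (g (unit_clamp u), g (unit_clamp v))).
  move=> [k [t [t0 tk incr ->]]] u0 uv v1.
  exists k.+1, (fun i => if (i <= k)%N then t i else unit_clamp v); split => //.
  - by rewrite ltnn unit_clampE// (le_trans u0) ?ltW.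
  - move=> i ik1; have [->|ik] : i = k \/ (i < k)%N.
      by move: ik1; rewrite ltnS leq_eqVlt => /orP[/eqP|]; [left|right].
      by rewrite leqnn ltnn tk unit_clampE// (le_trans u0) ?ltW.
    by rewrite (ltnW ik) ik; exact: incr.
  - rewrite [RHS]big_nat_recr //= ltnn leqnn sym -tk unit_clampK; congr (_ + _).
    by apply: eq_big_nat => -[|i] // /andP[_]; rewrite ltnS => ik; rewrite ik ltnW.
(* The empty partition of the degenerate interval: [k = 0]. *)
have S00 : S 0 0.
  exists 0%N, (fun=> unit_clamp 0); split => //.
  - by rewrite unit_clampE.
  - by rewrite unit_clampE.
  - by rewrite big_geq.
have S1 : ubound (S 1) M.
  move=> x [k [t [t0 tk incr ->]]]; rewrite -lee_fin; apply: le_trans leM.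
  by apply: ereal_sup_ubound; exists k, t.
have supS u : 0 <= u -> u <= 1 -> has_sup (S u).
  move=> u0 u1; split.
    move: u0; rewrite le_eqVlt => /orP[/eqP <-|u0]; first by exists 0.
    by exists (0 + rho (g (unit_clamp 0), g (unit_clamp u))); exact: S_app.
  exists M => x Sx; move: u1; rewrite [u <= 1]le_eqVlt => /orP[/eqP u1|u1].
    by apply: S1; rewrite -u1.
  by apply: le_trans (S1 _ (S_app _ _ _ Sx u0 u1 (lexx _))); rewrite lerDl.
exists (sup \o S) => [s t s0|/=].
  rewrite le_eqVlt => /orP[/eqP <-|st] t1.
    by rewrite subrr (rhoxx _ _).2.
  rewrite lerBrDr -lerBrDl; apply: ge_sup.
    by have [] := supS s s0 (le_trans (ltW st) t1).
  move=> x /S_app => /(_ _ s0 st t1) Sx.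
  rewrite lerBrDr; apply: sup_upper_bound Sx.
  by apply: supS => //; exact: le_trans s0 (ltW st).
have le1 : sup (S 1) <= M by apply: ge_sup => //; have [] := supS 1 ler01 (lexx _).
have le0 : 0 <= sup (S 0) by apply: (sup_upper_bound (supS 0 (lexx _) ler01)).
by lra.
Qed.

Lemma distance_le_length rho (g : `[0 : R, 1]%classic -> E) x y :
  distance rho ->
  (forall u, \val u = 0 -> g u = x) -> (forall u, \val u = 1 -> g u = y) ->
  ((rho (x, y))%:E <= curve_length rho g)%E.
Proof.
move=> [_ _ sym _] g0 g1; apply: ereal_sup_ubound.
exists 1%N, (fun i => unit_clamp i%:R); split.
- by rewrite unit_clampE.
- by rewrite unit_clampE.
- by case=> // _; rewrite !unit_clampE.
- by rewrite big_nat1 /= g1 ?g0 ?unit_clampE// sym.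
Qed.

Lemma curve_length_ge0 rho (g : `[0 : R, 1]%classic -> E) :
  distance rho -> (0 <= curve_length rho g)%E.
Proof.
move=> dist; have [rho0 _ _ _] := dist.
apply: le_trans (distance_le_length
  (x := g (unit_clamp 0)) (y := g (unit_clamp 1)) dist _ _).
- by rewrite lee_fin.
- by move=> u u0; rewrite -u0 unit_clampK.
- by move=> u u1; rewrite -u1 unit_clampK.
Qed.

Lemma le_curve_length rho rho' (g : `[0 : R, 1]%classic -> E) :
  (forall p, rho p <= rho' p) -> (curve_length rho g <= curve_length rho' g)%E.
Proof.
move=> le; apply: ge_ereal_sup => _ [k [t [t0 tk incr ->]]].
apply: le_trans (_ : ((\sum_(1 <= i < k.+1) rho' (g (t i), g (t i.-1)))%:E <= _)%E).
  by rewrite lee_fin; apply: ler_sum => i _; exact: le.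
by apply: ereal_sup_ubound; exists k, t.
Qed.

(** [x] and [y] are the ends of a Lipschitz curve of length at most [M]. *)
Definition joinable rho x y M := exists h phi K,
  [/\ controlled rho 0 1 h phi, controlled rho 0 1 h (fun t => K * t),
      h 0 = x, h 1 = y & phi 1 - phi 0 <= M].

Lemma lipschitz_controlled rho (g : `[0 : R, 1]%classic -> E) :
  lipschitz_curve rho g ->
  exists K, controlled rho 0 1 (g \o unit_clamp) (fun t => K * t).
Proof.
move=> [K lip]; exists K => s t s0 st t1 /=.
apply: le_trans (lip _ _) _; rewrite !unit_clampE ?(le_trans s0)//.
  by rewrite distrC ger0_norm ?subr_ge0// mulrBr.
exact: le_trans st t1.
Qed.

Lemma controlled_lipschitz rho (g : `[0 : R, 1]%classic -> E) K : distance rho ->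
  controlled rho 0 1 (g \o unit_clamp) (fun t => K * t) -> lipschitz_curve rho g.
Proof.
move=> [_ _ sym _] ctl; exists K => s t.
wlog st : s t / \val s <= \val t.
  move=> H; have [/H//|/ltW/H] := leP (\val s) (\val t).
  by rewrite sym distrC.
have := ctl (\val s) (\val t) (unitP _).1 st (unitP _).2.
by rewrite /= !unit_clampK distrC ger0_norm ?subr_ge0// mulrBr.
Qed.

(** Together with [joinable_length_space], this says that length spaces are the
    metric spaces in which any two points are joinable at a cost exceeding their
    distance by as little as desired. *)
Lemma length_space_joinable rho x y e : length_space rho -> 0 < e ->
  joinable rho x y (rho (x, y) + e).
Proof.
move=> [dist lsp] e0.
have := lsp x y; set S := [set curve_length rho g | g in _] => rhoE.
have : (ereal_inf S < (rho (x, y) + e)%:E)%E.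
  by rewrite -rhoE lte_fin ltrDl.
move=> /ereal_inf_lt[_ [g [/lipschitz_controlled[K ctlK] g0 g1] <-]] /ltW.
move=> /(length_controlled dist)[phi ctl le].
exists (g \o unit_clamp), phi, K; split => //=.
- by apply: g0; rewrite unit_clampE.
- by apply: g1; rewrite unit_clampE.
Qed.

Lemma restrict_clampE (h : R -> E) t : 0 <= t -> t <= 1 ->
  ((h \o \val) \o unit_clamp) t = h t.
Proof. by move=> t0 t1; congr h; exact: unit_clampE. Qed.

Lemma controlled_restrict rho h phi : controlled rho 0 1 h phi ->
  controlled rho 0 1 ((h \o \val) \o unit_clamp) phi.
Proof.
move=> ctl s t s0 st t1; rewrite !restrict_clampE ?(le_trans s0)//; first exact: ctl.
exact: le_trans st t1.
Qed.

Lemma joinable_length_space rho : distance rho ->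
  (forall x y e, 0 < e -> joinable rho x y (rho (x, y) + e)) ->
  length_space rho.
Proof.
move=> dist join; split => // x y; apply/eqP; rewrite eq_le; apply/andP; split.
  by apply: le_ereal_inf_tmp => _ [g [_ g0 g1] <-]; exact: distance_le_length.
apply/lee_addgt0Pr => e e0; have [h [phi [K [ctl ctlK h0 h1 le]]]] := join x y e e0.
apply: le_trans (_ : (curve_length rho (h \o \val) <= _)%E).
  apply: ereal_inf_lbound; exists (h \o \val) => //; split.
  - by apply: controlled_lipschitz dist (controlled_restrict ctlK).
  - by move=> t /= ->.
  - by move=> t /= ->.
apply: le_trans (curve_length_le dist (controlled_restrict ctl)) _.
by rewrite -EFinD lee_fin.
Qed.

Lemma controlled_le rho a b h phi s t : distance rho ->
  controlled rho a b h phi -> a <= s -> s <= t -> t <= b ->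
  phi s <= phi t.
Proof.
move=> [rho0 _ _ _] ctl as_ st tb.
by have := ctl s t as_ st tb; have := rho0 (h s) (h t); lra.
Qed.

(** The polygon is parametrised by [[0, N]], its [i]-th piece occupying
    [[i, i + 1]], so that a further piece is glued after a mere translation.
    On each piece the distance to the initial node is at most the length of the
    piece; this keeps a fine polygon close to the curve it interpolates. *)
Lemma joinable_chain rho (x : nat -> E) (M : nat -> R) N : distance rho ->
  (forall i, (i < N)%N -> joinable rho (x i) (x i.+1) (M i)) ->
  exists h phi K, [/\ controlled rho 0 N%:R h phi,
    controlled rho 0 N%:R h (fun t => K * t), h 0 = x 0%N, h N%:R = x N &
    phi N%:R - phi 0 <= \sum_(i < N) M i /\
    forall i : nat, (i < N)%N -> forall t, i%:R <= t -> t <= i.+1%:R ->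
      rho (x i, h t) <= M i].
Proof.
move=> dist; have [rho0 rhoxx _ tri] := dist; elim: N => [|N IH] join.
  exists (fun=> x 0%N), (fun=> 0), 0; split => //.
  - by move=> s t *; rewrite (rhoxx _ _).2// subrr.
  - by move=> s t *; rewrite (rhoxx _ _).2// !mul0r subrr.
  - by rewrite big_ord0 subrr; split.
have [|h1 [phi1 [K1 [ctl1 ctlK1 h10 h1N [le1 close1]]]]] := IH.
  by move=> i iN; apply: join; exact: ltnW.
have [h2 [phi2 [K2 [ctl2 ctlK2 h20 h21 le2]]]] := join N (ltnSn N).
have N0 : 0 <= N%:R :> R by rewrite ler0n.
have NN : N%:R <= N.+1%:R :> R by rewrite ler_nat.
have SN : N.+1%:R = N%:R + 1 :> R by rewrite -natr1.
(* The last piece moved to [[N, N + 1]], its arc length continuing [phi1]. *)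
pose h2' t := h2 (1 * t + (- N%:R)).
pose phi2' t := phi2 (1 * t + (- N%:R)) + (phi1 N%:R - phi2 0).
pose K := Num.max K1 K2.
have shift psi : controlled rho 0 1 h2 psi ->
    controlled rho N%:R N.+1%:R h2' (fun t => psi (1 * t + (- N%:R))).
  by apply: controlled_affine; rewrite // ?SN; lra.
have ctl2' : controlled rho N%:R N.+1%:R h2' phi2'.
  by apply: controlledW (shift _ ctl2) => s t _ _ _; rewrite /phi2'; lra.
have hN : h1 N%:R = h2' N%:R by rewrite h1N /h2' mul1r subrr.
have phiN : phi1 N%:R = phi2' N%:R by rewrite /phi2' mul1r subrr; lra.
have h2'1 : h2' N.+1%:R = h2 1 by rewrite /h2' SN; congr h2; ring.
exists (glue N%:R h1 h2'), (glue N%:R phi1 phi2'), K; split.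
- exact: controlled_glue ctl1 ctl2'.
- apply: controlledW (_ : controlled _ _ _ _ (glue N%:R ( *%R K) ( *%R K))).
    by move=> s t _ _ _; rewrite /glue !if_same.
  apply: controlled_glue => //.
    apply: controlledW ctlK1 => s t _ st _.
    by rewrite -!mulrBr ler_wpM2r ?subr_ge0// le_max lexx.
  apply: controlledW (shift _ ctlK2) => s t _ st _.
  rewrite -!mulrBr (_ : _ - (_ : R) = t - s); last by ring.
  by rewrite ler_wpM2r ?subr_ge0// le_max lexx orbT.
- by rewrite /glue N0.
- by rewrite glue_r// h2'1.
- split.
    rewrite glue_r// /glue N0 big_ord_recr /= /phi2' SN.
    rewrite (_ : 1 * _ + _ = 1); last by ring.
    by lra.
  move=> i; rewrite ltnS leq_eqVlt => /orP[/eqP -> t Nt tN|iN t it ti].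
    rewrite glue_r// /h2' -h20.
    set u := 1 * t + _.
    have u0 : 0 <= u by rewrite /u; lra.
    have u1 : u <= 1 by rewrite /u -(lerD2r N%:R); rewrite SN in tN; lra.
    have := ctl2 0 u (lexx _) u0 u1.
    have := controlled_le dist ctl2 u0 u1 (lexx _).
    by lra.
  rewrite /glue (le_trans ti) ?ler_nat//.
  exact: close1.
Qed.


(** * Polygons inscribed in a curve *)

Definition node (g : `[0 : R, 1]%classic -> E) (N i : nat) : E :=
  g (unit_clamp (i%:R / N%:R)).

Lemma val_unit_clamp_node N i : (0 < N)%N -> (i <= N)%N ->
  \val (unit_clamp (i%:R / N%:R)) = i%:R / N%:R.
Proof.
move=> N0 iN; apply: unit_clampE; first by rewrite divr_ge0 ?ler0n.
by rewrite ler_pdivrMr ?ltr0n// mul1r ler_nat.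
Qed.

Lemma node_sum_le_length rho (g : `[0 : R, 1]%classic -> E) N :
  distance rho -> (0 < N)%N ->
  ((\sum_(i < N) rho (node g N i, node g N i.+1))%:E <= curve_length rho g)%E.
Proof.
move=> [_ _ sym _] N0; have N0' : 0 < N%:R :> R by rewrite ltr0n.
apply: ereal_sup_ubound; exists N, (fun i => unit_clamp (i%:R / N%:R)); split.
- by rewrite val_unit_clamp_node// mul0r.
- by rewrite val_unit_clamp_node// divff// gt_eqF.
- move=> i iN; rewrite !val_unit_clamp_node//; last exact: ltnW.
  by rewrite ltr_pM2r ?invr_gt0// ltr_nat.
- rewrite big_add1 /= big_mkord; congr (_%:E).
  by apply: eq_bigr => i _; rewrite sym.
Qed.

Lemma subinterval_index N (u : R) : (0 < N)%N -> 0 <= u -> u <= N%:R ->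
  exists2 i : nat, (i < N)%N & i%:R <= u /\ u <= i.+1%:R.
Proof.
elim: N => // N IH _ u0 uN; have [Nu|/ltW uN'] := leP N%:R u.
  by exists N.
move: uN'; case: N IH uN => [|N] IH uN uN'.
  by exists 0%N => //; split => //; apply: le_trans uN' _.
by have [i iN ?] := IH isT u0 uN'; exists i => //; exact: ltnW.
Qed.

Lemma joinable_polygon rho (x : nat -> E) (M : nat -> R) N :
  distance rho -> (0 < N)%N ->
  (forall i, (i < N)%N -> joinable rho (x i) (x i.+1) (M i)) ->
  exists h phi K, [/\ controlled rho 0 1 h phi,
    controlled rho 0 1 h (fun t => K * t), h 0 = x 0%N, h 1 = x N &
    phi 1 - phi 0 <= \sum_(i < N) M i /\
    forall t, 0 <= t -> t <= 1 -> exists2 i, (i < N)%N &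
      [/\ i%:R / N%:R <= t, t <= i.+1%:R / N%:R & rho (x i, h t) <= M i]].
Proof.
move=> dist N0 join; have N0' : 0 < N%:R :> R by rewrite ltr0n.
have [h [phi [K [ctl ctlK h0 hN [le close]]]]] := joinable_chain dist join.
pose h' t := h (N%:R * t + 0).
have rescale psi : controlled rho 0 N%:R h psi ->
    controlled rho 0 1 h' (fun t => psi (N%:R * t + 0)).
  apply: controlled_affine; first exact: ltW.
    by rewrite mulr0 addr0.
  by rewrite mulr1 addr0.
exists h', (fun t => phi (N%:R * t + 0)), (K * N%:R); split.
- exact: rescale.
- apply: controlledW (rescale _ ctlK) => s t _ _ _.
  by rewrite !addr0 !mulrA.
- by rewrite /h' mulr0 addr0.
- by rewrite /h' mulr1 addr0.
- split; first by rewrite mulr1 mulr0 !addr0.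
  move=> t t0 t1.
  have [||i iN [it ti]] := @subinterval_index N (N%:R * t) N0.
  + by rewrite mulr_ge0// ltW.
  + by rewrite ler_piMr// ltW.
  exists i => //; split.
  + by rewrite ler_pdivrMr// mulrC.
  + by rewrite ler_pdivlMr// mulrC.
  + by rewrite /h' addr0; exact: close.
Qed.

Lemma joinable_sum rho (x : nat -> E) (M : nat -> R) N :
  distance rho -> (0 < N)%N ->
  (forall i, (i < N)%N -> joinable rho (x i) (x i.+1) (M i)) ->
  joinable rho (x 0%N) (x N) (\sum_(i < N) M i).
Proof.
move=> dist N0 /(joinable_polygon dist N0)[h [phi [K [? ? ? ? [? _]]]]].
by exists h, phi, K.
Qed.

Lemma joinableW rho x y M M' : M <= M' -> joinable rho x y M -> joinable rho x y M'.
Proof.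
move=> MM' [h [phi [K [? ? ? ? le]]]]; exists h, phi, K; split => //.
exact: le_trans le MM'.
Qed.

(** Join successive nodes at a cost exceeding their distance by [e / N]: the
    [N] errors add up to [e]. *)
Lemma polygon_approx rho (g : `[0 : R, 1]%classic -> E) N e :
  length_space rho -> (0 < N)%N -> 0 < e ->
  exists h : `[0 : R, 1]%classic -> E,
  [/\ lipschitz_curve rho h,
      (curve_length rho h <=
       (\sum_(i < N) rho (node g N i, node g N i.+1) + e)%:E)%E
    & forall t, exists2 i, (i < N)%N &
        [/\ i%:R / N%:R <= \val t, \val t <= i.+1%:R / N%:R
          & rho (node g N i, h t) <= rho (node g N i, node g N i.+1) + e]].
Proof.
move=> lsp N0 e0; have dist := lsp.1.
have N0' : 0 < N%:R :> R by rewrite ltr0n.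
have eN0 : 0 < e / N%:R by rewrite divr_gt0.
have [|h [phi [K [ctl ctlK _ _ [le close]]]]] := @joinable_polygon rho (node g N)
    (fun i => rho (node g N i, node g N i.+1) + e / N%:R) N dist N0.
  by move=> i _; exact: length_space_joinable.
exists (h \o \val); split.
- exact: controlled_lipschitz dist (controlled_restrict ctlK).
- apply: le_trans (curve_length_le dist (controlled_restrict ctl)) _.
  rewrite lee_fin; apply: le_trans le _.
  rewrite big_split /= sumr_const card_ord -[_ *+ N]mulr_natr divfK//.
  by rewrite gt_eqF.
- move=> t; have [t0 t1] := unitP t.
  have [i iN [it ti le_i]] := close _ t0 t1; exists i => //; split => //.
  apply: le_trans le_i _.
  by rewrite lerD2l ler_pdivrMr// ler_peMr ?ler1n// ltW.
Qed.

(** It is enough to compare [rho] with the increments of [phi] at small scale: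
    subdivide [[s, t]] finely, add up with the triangle inequality on the left
    and telescope on the right. *)
Lemma controlled_local rho h phi e : distance rho -> 0 < e ->
  (forall s t, 0 <= s -> s <= t -> t <= 1 -> t - s <= e ->
     rho (h s, h t) <= phi t - phi s) ->
  controlled rho 0 1 h phi.
Proof.
move=> [_ rhoxx _ tri] e0 local s t s0 st t1.
pose N := (Num.truncn ((t - s) / e)).+1.
have N0 : 0 < N%:R :> R by rewrite ltr0n.
pose w := (t - s) / N%:R.
have w0 : 0 <= w by rewrite divr_ge0// subr_ge0.
have we : w <= e.
  rewrite ler_pdivrMr// mulrC -ler_pdivrMr//; apply: ltW.
  by rewrite truncnS_gt.
have wN : N%:R * w = t - s by rewrite mulrC divfK// gt_eqF.
pose u i : R := s + i%:R * w.
have uS i : u i.+1 = u i + w by rewrite /u -natr1 mulrDl mul1r addrA.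
(* [u i] are the [N + 1] equidistant points from [s] to [t]. *)
suff claim i : (i <= N)%N -> rho (h s, h (u i)) <= phi (u i) - phi s.
  by have := claim N (leqnn _); rewrite /u wN addrC subrK.
elim: i => [_|i IH iN]; first by rewrite /u mul0r addr0 subrr (rhoxx _ _).2.
apply: le_trans (tri _ (h (u i)) _) _.
have ui0 : 0 <= u i by rewrite /u addr_ge0// mulr_ge0.
have ui1 : u i.+1 <= t.
  by rewrite /u addrC -lerBrDr -wN ler_wpM2r// ler_nat.
have := IH (ltnW iN).
have : u i <= u i.+1 by rewrite uS lerDl.
move=> /(local _ _ ui0)/(_ (le_trans ui1 t1)).
by rewrite uS addrC addKr => /(_ we); lra.
Qed.

End Control.

(** * Lower and upper limits, diagonal sequences *)

Lemma limn_esup_le (R : realType) (u : nat -> \bar R) (c : \bar R) :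
  (\forall n \near \oo, (u n <= c)%E) -> (limn_esup u <= c)%E.
Proof.
move=> H; rewrite /limn_esup limf_esupE; apply: ge_ereal_inf.
exists (ereal_sup (u @` [set n | (u n <= c)%E]));
  first by exists [set n | (u n <= c)%E].
by apply: ge_ereal_sup => _ [n /= ? <-].
Qed.

Lemma limn_einf_ge (R : realType) (u : nat -> \bar R) (c : \bar R) :
  (\forall n \near \oo, (c <= u n)%E) -> (c <= limn_einf u)%E.
Proof.
move=> H; rewrite /limn_einf leeNr; apply: limn_esup_le.
by apply: filterS H => n /=; rewrite leeN2.
Qed.

Lemma le_limn_esup (R : realType) (u v : nat -> \bar R) :
  (\forall n \near \oo, (u n <= v n)%E) -> (limn_esup u <= limn_esup v)%E.
Proof.
move=> uv; rewrite /limn_esup !limf_esupE; apply: le_ereal_inf_tmp => _ [V V_oo <-].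
apply: ge_ereal_inf.
exists (ereal_sup (u @` (V `&` [set n | (u n <= v n)%E]))).
  by exists (V `&` [set n | (u n <= v n)%E]) => //; exact: filterI.
apply: ge_ereal_sup => _ [n [Vn uvn] <-]; apply: le_trans uvn _.
by apply: ereal_sup_ubound; exists n.
Qed.

Lemma le_limn_einf (R : realType) (u v : nat -> \bar R) :
  (\forall n \near \oo, (u n <= v n)%E) -> (limn_einf u <= limn_einf v)%E.
Proof.
move=> uv; rewrite /limn_einf leeN2; apply: le_limn_esup.
by apply: filterS uv => n /=; rewrite leeN2.
Qed.

(** At stage [n], take an [x] satisfying [P k n] for the largest [k <= n] for
    which this is possible; as the conditions weaken when [k] decreases, a given
    [k] is honoured as soon as [n >= k] and [P k n] is satisfiable. *)
Lemma diagonal_sequence (T : Type) (x0 : T) (P : nat -> nat -> T -> Prop) :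
  (forall k n x, P k.+1 n x -> P k n x) ->
  (forall k, \forall n \near \oo, exists x, P k n x) ->
  exists x_ : nat -> T, forall k, \forall n \near \oo, P k n (x_ n).
Proof.
move=> dec ex.
have dec_le k m n x : (k <= m)%N -> P m n x -> P k n x.
  elim: m => [|m IH]; first by rewrite leqn0 => /eqP ->.
  by rewrite leq_eqVlt => /orP[/eqP ->//|km] /dec; exact: IH.
have best n : exists x, forall k, (k <= n)%N -> (exists y, P k n y) -> P k n x.
  suff : forall m, exists x, forall k, (k <= m)%N -> (exists y, P k n y) -> P k n x.
    by apply.
  elim=> [|m [x IH]].
    have [[x Px]|nP] := pselect (exists y, P 0%N n y).
      by exists x => k; rewrite leqn0 => /eqP ->.
    by exists x0 => k; rewrite leqn0 => /eqP ->.
  have [[y Py]|nP] := pselect (exists y, P m.+1 n y).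
    by exists y => k km _; exact: dec_le km Py.
  exists x => k; rewrite leq_eqVlt => /orP[/eqP ->//|km].
  exact: IH.
have [x_ x_P] := choice best.
exists x_ => k; near=> n; apply: x_P; first by near: n; exact: nbhs_infty_ge.
by near: n; exact: ex.
Unshelve. all: by end_near. Qed.

(** * Convergence of curves and of distances *)

Lemma Lip01_cvgP (R : realType) (X : metricType R) (Omega : set X)
    (g_ : nat -> Lip01 Omega) (g : Lip01 Omega) :
  g_ @ \oo --> g <->
  forall e : R, 0 < e -> \forall n \near \oo,
    forall t, restr_mdist (\val (g_ n) t, \val g t) < e.
Proof.
split.
- move=> cv e e0.
  have cv' : \val (g_ n) @[n --> \oo] --> \val g.
    by apply: cvg_comp cv _; exact: initial_continuous.
  have := cv' [set h | forall t, restr_mdist (h t, \val g t) < e].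
  apply.
  apply/uniform_nbhs.
  exists [set xy | ball xy.1 e xy.2]; split.
    by exists [set xy : X * X | ball xy.1 e xy.2] => //; exact: entourage_ball (PosNum e0).
  move=> h /= H t; have := H t I.
  have -> : ball ((\val g) t) e (h t) = ball (\val (\val g t)) e (\val (h t)) by [].
  by rewrite ballEmdist /= /restr_mdist /= metric_sym.
- move=> H A /= [_ [[B Bo <-] Bg] sBA].
  have : nbhs (\val g) B by apply: open_nbhs_nbhs; split.
  move=> /uniform_nbhs [E [[E' entE' sE] EB]].
  move: entE' => /=; rewrite -entourage_ballE => -[e /= e0 eE].
  near=> n. apply: sBA => /=. apply: EB => /= t _.
  apply: sE => /=. apply: eE => /=. rewrite ballEmdist /=.
  rewrite metric_sym. move: t. near: n. exact: H.
Unshelve. all: by end_near. Qed.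

(** Singletons are compact. *)
Lemma Dclass_cvg_pointwise (R : realType) (X : metricType R) (Omega : set X)
    (alpha : R)
    (d_ : nat -> Dclass alpha Omega) (d : Dclass alpha Omega) :
  d_ @ \oo --> d -> forall p, \val (d_ n) p @[n --> \oo] --> \val d p.
Proof.
move=> cv p.
have cv' : \val (d_ n) @[n --> \oo] --> \val d.
  by apply: cvg_comp cv _; exact: initial_continuous.
have /fam_cvgP/(_ _ (@compact_set1 _ p)) :
    {family compact, (fun n => \val (d_ n)) @ \oo --> \val d}.
  exact: cv'.
by rewrite uniform_set1.
Qed.

(** * Gamma-convergence from pointwise convergence *)

Lemma distance_quadrilateral (R : realType) (E : Type) (rho : E * E -> R) p q p' q' :
  distance rho -> `|rho (p', q') - rho (p, q)| <= rho (p', p) + rho (q', q).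
Proof.
move=> [rho0 _ sym tri].
have := tri p' p q'; have := tri p q q'.
have := tri p p' q; have := tri p' q' q.
by rewrite (sym p p') (sym q q') ler_norml => *; apply/andP; split; lra.
Qed.

Section Domain.
Context {R : realType} {X : metricType R} {alpha : R} {Omega : set X}.
Hypothesis alpha1 : 1 < alpha.
Local Notation D := (@restr_mdist R X Omega).
Implicit Types (d : Dclass alpha Omega) (g : Lip01 Omega).

Let alpha0 : 0 < alpha. Proof. exact: lt_trans alpha1. Qed.

Lemma Dclass_length_space d : length_space (\val d).
Proof. by have [] := set_valP d. Qed.

Lemma Dclass_distance d : distance (\val d).
Proof. exact: (Dclass_length_space d).1. Qed.

Lemma Dclass_le d p : \val d p <= alpha * D p.
Proof. by have [_ /(_ p) /andP[]] := set_valP d. Qed.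

Lemma Dclass_ge d p : D p <= alpha * \val d p.
Proof.
by have [_ /(_ p) /andP[+ _]] := set_valP d; rewrite ler_pdivrMl.
Qed.

Lemma restr_mdist_sym x y : D (x, y) = D (y, x).
Proof. exact: metric_sym. Qed.

Lemma restr_mdist_triangle x y z : D (x, z) <= D (x, y) + D (y, z).
Proof. exact: metric_triangle. Qed.

(** Curves produced by the length-space property of [d] are Lipschitz for [d];
    the comparison of [d] with [D] places them in the space of curves. *)
Lemma Dclass_lipschitz d (g : `[0 : R, 1]%classic -> Omega) :
  lipschitz_curve (\val d) g -> Lip01 Omega g.
Proof.
move=> [K lip]; exists (alpha * K) => s t; apply: le_trans (Dclass_ge d _) _.
by rewrite -mulrA ler_pM2l//.
Qed.

(** The bound [d_n <= alpha D], uniform in [n], turns convergence of points for [D]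
    into convergence for all [d_n] at once, and [distance_quadrilateral] bounds
    the effect of moving the points. *)
Lemma Dclass_cvg_along (d_ : nat -> Dclass alpha Omega) d (p_ q_ : nat -> Omega) p q :
  \val (d_ n) (p, q) @[n --> \oo] --> \val d (p, q) ->
  (forall e : R, 0 < e -> \forall n \near \oo, D (p_ n, p) < e) ->
  (forall e : R, 0 < e -> \forall n \near \oo, D (q_ n, q) < e) ->
  \val (d_ n) (p_ n, q_ n) @[n --> \oo] --> \val d (p, q).
Proof.
move=> cvd cvp cvq; apply/cvgrPdist_le => e e0.
have e3 : 0 < e / 3 by lra.
have ea : 0 < e / 3 / alpha by rewrite divr_gt0.
move/cvgrPdist_le/(_ _ e3) : cvd => cvd.
near=> n.
have : `|\val d (p, q) - \val (d_ n) (p, q)| <= e / 3 by near: n.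
have : \val (d_ n) (p_ n, p) <= e / 3.
  apply: le_trans (Dclass_le _ _) _; rewrite mulrC -ler_pdivlMr//.
  by apply: ltW; near: n; exact: cvp.
have : \val (d_ n) (q_ n, q) <= e / 3.
  apply: le_trans (Dclass_le _ _) _; rewrite mulrC -ler_pdivlMr//.
  by apply: ltW; near: n; exact: cvq.
have := distance_quadrilateral p q (p_ n) (q_ n) (Dclass_distance (d_ n)).
rewrite !ler_norml => /andP[? ?] ? ? /andP[? ?].
by apply/andP; split; lra.
Unshelve. all: by end_near. Qed.

(** A supremum of functions that pass to the limit is lower semicontinuous. *)
Lemma length_liminf (d_ : nat -> Dclass alpha Omega) d (g_ : nat -> Lip01 Omega) g :
  (forall p, \val (d_ n) p @[n --> \oo] --> \val d p) -> g_ @ \oo --> g ->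
  (Lip_length d g <= limn_einf (fun n => Lip_length (d_ n) (g_ n)))%E.
Proof.
move=> cvd /Lip01_cvgP cvg; apply: ge_ereal_sup => _ [k [t [t0 tk incr ->]]].
set s := \sum_(1 <= i < k.+1) _.
have cvs : \sum_(1 <= i < k.+1) \val (d_ n) (\val (g_ n) (t i), \val (g_ n) (t i.-1))
    @[n --> \oo] --> s.
  apply: cvg_big => [|i _]; [exact: add_continuous|].
  apply: Dclass_cvg_along => // e /cvg;
    by apply: filterS => n; exact.
apply/lee_subgt0Pr => e e0; apply: limn_einf_ge.
have se : s - e < s by rewrite gtrBl.
apply: filterS (cvgr_gt _ cvs _ se) => n /ltW le_s; apply: le_trans (_ : _ <= _%:E)%E _.
  by rewrite -EFinB lee_fin; exact: le_s.
by apply: ereal_sup_ubound; exists k, t.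
Qed.

(** With a Lipschitz constant [C] of [g], consecutive nodes are at distance at
    most [C / N], so the polygon starts each piece on [g] and leaves its node by
    at most [alpha * (alpha * C / N + e')], while [g] leaves it by at most
    [C / N].  The sum [A / N + alpha * e'], with [A] as below, is made smaller
    than [e] by the choices of [N] and [e']; [n] is chosen last, to compare
    finitely many distances between nodes. *)
Lemma recovery_curves (d_ : nat -> Dclass alpha Omega) d g e :
  (forall p, \val (d_ n) p @[n --> \oo] --> \val d p) -> 0 < e ->
  \forall n \near \oo, exists h : Lip01 Omega,
    (Lip_length (d_ n) h <= Lip_length d g + e%:E)%E /\
    forall t, D (\val h t, \val g t) < e.
Proof.
move=> cvd e0.
have [C0 lipg] := set_valP g; pose C := Num.max C0 0.
have C_ge0 : 0 <= C by rewrite le_max lexx orbT.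
have lipC s t : D (\val g s, \val g t) <= C * `|\val s - \val t|.
  by apply: le_trans (lipg s t) _; rewrite ler_wpM2r// le_max lexx.
pose A := C + alpha * (alpha * C).
have A0 : 0 <= A by rewrite addr_ge0// !mulr_ge0// ltW.
pose N := (Num.truncn (A / (e / 3))).+1.
have N0' : 0 < N%:R :> R by rewrite ltr0n.
have AN : A / N%:R < e / 3.
  rewrite ltr_pdivrMr// mulrC -ltr_pdivrMr; last by lra.
  by rewrite truncnS_gt.
pose e' := e / 3 / alpha.
have e'0 : 0 < e' by rewrite !divr_gt0.
have e'e : e' <= e / 3.
  by rewrite ler_pdivrMr// ler_peMr ?ltW//; lra.
pose x i := node (\val g) N i.
have cvs : \sum_(i < N) \val (d_ n) (x i, x i.+1) @[n --> \oo] -->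
    \sum_(i < N) \val d (x i, x i.+1)
  by apply: cvg_big => [|i _]; [exact: add_continuous|]; exact: cvd.
have e3 : 0 < e / 3 by lra.
move/cvgrPdist_le/(_ _ e3) : cvs; apply: filterS => n.
rewrite ler_norml => /andP[les _].
have [h [liph leh closeh]] :=
  @polygon_approx _ _ _ (\val g) N e' (Dclass_length_space (d_ n)) isT e'0.
exists (exist _ h (mem_set (Dclass_lipschitz liph))); split.
  apply: le_trans leh _.
  apply: le_trans (_ : _ <= (\sum_(i < N) \val d (x i, x i.+1) + e)%:E)%E _.
    by rewrite lee_fin; rewrite /x in les *; lra.
  by rewrite EFinD leeD2r//; exact: node_sum_le_length (Dclass_distance d) _.
move=> t; have [i iN [it ti le]] := closeh t; rewrite [X in D (X, _)]/=.
have SiN : i.+1%:R / N%:R = i%:R / N%:R + N%:R^-1 :> R.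
  by rewrite -natr1 mulrDl mul1r.
have Dg : D (x i, \val g t) <= C / N%:R.
  apply: le_trans (lipC _ _) _; rewrite ler_wpM2l// val_unit_clamp_node// 1?ltnW//.
  by rewrite distrC ger0_norm ?subr_ge0//; lra.
have Dx : D (x i, x i.+1) <= C / N%:R.
  apply: le_trans (lipC _ _) _; rewrite ler_wpM2l// !val_unit_clamp_node ?(ltnW iN)//.
  by rewrite SiN opprD addNKr normrN ger0_norm// invr_ge0 ler0n.
have Dh : D (x i, h t) <= alpha * (alpha * C / N%:R + e').
  apply: le_trans (Dclass_ge (d_ n) _) _; rewrite ler_pM2l//.
  apply: le_trans le _; rewrite lerD2r; apply: le_trans (Dclass_le _ _) _.
  by rewrite -mulrA ler_pM2l.
apply: le_lt_trans (restr_mdist_triangle _ (x i) _) _.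
rewrite restr_mdist_sym; apply: le_lt_trans (lerD Dh Dg) _.
have -> : alpha * (alpha * C / N%:R + e') + C / N%:R = A / N%:R + e / 3.
  rewrite /A /e'; field.
  by rewrite !gt_eqF.
by lra.
Qed.

Lemma gamma_cvg_of_pointwise (d_ : nat -> Dclass alpha Omega) d :
  (forall p, \val (d_ n) p @[n --> \oo] --> \val d p) ->
  gamma_cvg (fun n => Lip_length (d_ n)) (Lip_length d).
Proof.
move=> cvd g; split => [g_|]; first exact: length_liminf.
pose P k n (h : Lip01 Omega) :=
  (Lip_length (d_ n) h <= Lip_length d g + (k.+1%:R^-1)%:E)%E /\
  forall t, D (\val h t, \val g t) < k.+1%:R^-1.
have [|k|h_ h_P] := @diagonal_sequence _ g P.
- move=> k n h [le close].
  have lek : k.+2%:R^-1 <= k.+1%:R^-1 :> R by rewrite lef_pV2 ?posrE ?ltr0n// ler_nat.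
  split; last by move=> t; apply: lt_le_trans (close t) lek.
  by apply: le_trans le _; rewrite leeD2l// lee_fin.
- by apply: recovery_curves => //; rewrite invr_gt0 ltr0n.
have small e : 0 < e -> exists k : nat, k.+1%:R^-1 < e :> R.
  by move=> e0;
    have [k _ /(_ k) /= H] := near_infty_natSinv_lt (PosNum e0);
    exists k; exact: H.
exists h_.
  apply/Lip01_cvgP => e /small[k ke]; apply: filterS (h_P k) => n [_ close] t.
  exact: lt_trans (close t) ke.
apply/lee_addgt0Pr => e /small[k ke]; apply: limn_esup_le.
apply: filterS (h_P k) => n [le _]; apply: le_trans le _.
by rewrite leeD2l// lee_fin ltW.
Qed.

End Domain.

(** * The plane with the maximum metric *)

(** A copy of the product type, on which the metric inducing the product
    uniformity can be declared. *)
Definition plane (R : realType) : Type := (R * R)%type.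

HB.instance Definition _ (R : realType) :=
  PseudoMetric.copy (plane R) (R * R)%type.

Section PlaneMetric.
Context {R : realType}.
Implicit Types p q : plane R.

Definition max_dist p q : R := Num.max `|p.1 - q.1| `|p.2 - q.2|.

Let max_dist_ge0 p q : 0 <= max_dist p q.
Proof. by rewrite le_max normr_ge0. Qed.

Let max_dist_eq0 p q : max_dist p q = 0 -> p = q.
Proof.
move=> pq; have : max_dist p q <= 0 by rewrite pq.
rewrite ge_max !normr_le0 !subr_eq0 => /andP[/eqP p1 /eqP p2].
by rewrite [p]surjective_pairing [q]surjective_pairing p1 p2.
Qed.

Let ball_max_dist p e : ball p e = [set q | max_dist p q < e].
Proof. by apply/seteqP; split => q /=; rewrite /max_dist gt_max => /andP. Qed.

HB.instance Definition _ := PseudoMetric_isMetric.Build R (plane R)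
  max_dist_ge0 max_dist_eq0 ball_max_dist.

End PlaneMetric.

Section PlaneTopology.
Context {R : realType}.

Lemma locally_compact_plane : locally_compact [set: plane R].
Proof.
move=> p _; rewrite withinET.
have near_closed_ball (x : R) : nbhs x (closed_ball x 1).
  by apply/nbhs_closedballP; exists 1%:pos.
have compK : compact (closed_ball p.1 1 `*` closed_ball p.2 1 : set (plane R)).
  by apply: compact_setX; exact: closed_ballR_compact.
exists (closed_ball p.1 1 `*` closed_ball p.2 1).
  by exists (closed_ball p.1 1, closed_ball p.2 1); [split|].
split => //; apply: compact_closed compK; exact: (@metric_hausdorff R (plane R)).
Qed.

Lemma complete_plane : complete_space (plane R).
Proof.
move=> F FF /cauchy_ballP Fc.
have c1 : cvg (fst @ F).
  apply: cauchy_cvg; apply/cauchy_ballP => e e0.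
  case: (Fc e e0) => [[A B] [/= FA FB] AB].
  exists (fst @` A, fst @` B) => /=.
    split; [apply: filterS FA|apply: filterS FB] => x Ax /=; exists x => //.
  by move=> [_ _] [/= [x Ax <-] [y By <-]]; have [] := AB (x, y).
have c2 : cvg (snd @ F).
  apply: cauchy_cvg; apply/cauchy_ballP => e e0.
  case: (Fc e e0) => [[A B] [/= FA FB] AB].
  exists (snd @` A, snd @` B) => /=.
    split; [apply: filterS FA|apply: filterS FB] => x Ax /=; exists x => //.
  by move=> [_ _] [/= [x Ax <-] [y By <-]]; have [] := AB (x, y).
exists (lim (fst @ F), lim (snd @ F)).
suff : (p.1, p.2) @[p --> F] --> (lim (fst @ F), lim (snd @ F)).
  by have -> : (fun p : plane R => (p.1, p.2)) = id by apply/funext => -[].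
exact: (cvg_pair (f := fst) (g := snd) c1 c2).
Qed.

Definition half_plane : set (plane R) := [set p | 0 < p.2].

Lemma open_half_plane : open half_plane.
Proof.
have -> : half_plane = snd @^-1` [set y : R | 0 < y] by [].
by apply: open_comp => [p _|]; [exact: cvg_snd | exact: open_gt].
Qed.

End PlaneTopology.

(** * The half-plane with a cheap strip along its boundary *)

Section Shortcut.
Context {R : realType}.
Local Notation H := (@half_plane R).
Implicit Types (p q : H) (h : R).

Definition abscissa p : R := (\val p).1.
Definition height p : R := (\val p).2.

Lemma half_mdistE p q :
  restr_mdist (p, q) = Num.max `|abscissa p - abscissa q| `|height p - height q|.
Proof. by []. Qed.

(** The length distance for which a horizontal unit costs 2 and a vertical one
    costs 1; it is reached along the straight segment. *)
Definition direct (pq : H * H) : R :=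
  2 * `|abscissa pq.1 - abscissa pq.2| + `|height pq.1 - height pq.2|.

(** The cost of reaching the strip of height [h], crossing it at horizontal cost 1
    and climbing to the target: vertically this takes
    [(y - h) + (y' - h)] when both heights exceed [h], and [|y - y'|] when one
    of the points already lies in the strip. *)
Definition detour h (pq : H * H) : R :=
  `|abscissa pq.1 - abscissa pq.2| +
  Num.max `|height pq.1 - height pq.2|
          (height pq.1 + height pq.2 - 2 * h).

(** The length distance of the half-plane in which horizontal motion costs 1 at
    heights at most [h] and 2 above. *)
Definition short h (pq : H * H) : R := Num.min (direct pq) (detour h pq).

Lemma half_plane_gt0 p : 0 < height p.
Proof. exact: set_valP p. Qed.

Lemma dist_le_direct pq : restr_mdist pq <= direct pq.
Proof.
case: pq => p q; rewrite half_mdistE /direct /= ge_max.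
have := normr_ge0 (abscissa p - abscissa q); have := normr_ge0 (height p - height q).
by move=> ? ?; apply/andP; split; lra.
Qed.

Lemma dist_le_short h pq : restr_mdist pq <= short h pq.
Proof.
rewrite le_min dist_le_direct /=; case: pq => p q; rewrite half_mdistE /detour /= ge_max.
set m := Num.max _ (_ - 2 * h).
have : `|height p - height q| <= m by rewrite le_max lexx.
have := normr_ge0 (abscissa p - abscissa q); have := normr_ge0 (height p - height q).
by move=> ? ? ?; apply/andP; split; lra.
Qed.

Lemma direct_le_dist pq : direct pq <= 3 * restr_mdist pq.
Proof.
case: pq => p q; rewrite half_mdistE /direct /=; set m := Num.max _ _.
have : `|abscissa p - abscissa q| <= m by rewrite le_max lexx.
have : `|height p - height q| <= m by rewrite le_max lexx orbT.
by lra.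
Qed.

Lemma short_le_direct h pq : short h pq <= direct pq.
Proof. by rewrite ge_min lexx. Qed.

(** Far above the strip, nearby points gain nothing from it. *)
Lemma short_eq_direct h pq :
  direct pq <= height pq.1 + height pq.2 - 2 * h -> short h pq = direct pq.
Proof.
move=> le; apply/min_idPl; apply: le_trans le _; rewrite /detour.
set m := Num.max _ _; have : height pq.1 + height pq.2 - 2 * h <= m.
  by rewrite le_max lexx orbT.
by have := normr_ge0 (abscissa pq.1 - abscissa pq.2); lra.
Qed.

Lemma direct_distance : distance direct.
Proof.
split=> [p q|p q|p q|p q r]; rewrite /direct /=.
- by rewrite addr_ge0// mulr_ge0.
- split=> [pq|->]; last by rewrite !subrr normr0 mulr0 addr0.
  apply: val_inj; apply: mdist_positivity.
  apply/eqP; rewrite eq_le mdist_ge0 andbT.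
  by apply: le_trans (dist_le_direct (p, q)) _; rewrite /direct /= pq.
- by rewrite distrC [X in _ + X]distrC.
- have := ler_distD (abscissa q) (abscissa p) (abscissa r).
  have := ler_distD (height q) (height p) (height r).
  by lra.
Qed.

(** For the triangle inequality, the vertical part of the detour grows by at most
    [|y - y'|] when an end moves vertically; so a direct route preceding or
    following a detour can be replaced by one single detour. *)
Lemma short_distance h : distance (short h).
Proof.
split=> [p q|p q|p q|p q r].
- by apply: le_trans (dist_le_short h (p, q)); exact: mdist_ge0.
- split=> [pq|->].
    apply: val_inj; apply: mdist_positivity.
    apply/eqP; rewrite eq_le mdist_ge0 andbT.
    by apply: le_trans (dist_le_short h (p, q)) _; rewrite pq.
  apply/eqP; rewrite eq_le; apply/andP; split.
    apply: le_trans (short_le_direct _ _) _.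
    by have [_ dxx _ _] := direct_distance; rewrite (dxx _ _).2.
  by apply: le_trans (dist_le_short h (q, q)); exact: mdist_ge0.
- rewrite /short /direct /detour /= distrC [`|height _ - _|]distrC.
  by rewrite [height p + _]addrC.
- rewrite /short /direct /detour /=.
  set Fpr := Num.max _ (height p + height r - _).
  set Fpq := Num.max _ (height p + height q - _).
  set Fqr := Num.max _ (height q + height r - _).
  have := ler_distD (abscissa q) (abscissa p) (abscissa r).
  have := ler_distD (height q) (height p) (height r).
  have Fpq1 : `|height p - height q| <= Fpq by rewrite le_max lexx.
  have Fpq2 : height p + height q - 2 * h <= Fpq by rewrite le_max lexx orbT.
  have Fqr1 : `|height q - height r| <= Fqr by rewrite le_max lexx.
  have Fqr2 : height q + height r - 2 * h <= Fqr by rewrite le_max lexx orbT.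
  have rq : height r - height q <= `|height q - height r|.
    by rewrite distrC ler_norm.
  have pq : height p - height q <= `|height p - height q| by exact: ler_norm.
  move=> ? ?.
  have F1 : Fpr <= Fpq + `|height q - height r|.
    by rewrite ge_max; apply/andP; split; lra.
  have F2 : Fpr <= `|height p - height q| + Fqr.
    by rewrite ge_max; apply/andP; split; lra.
  rewrite ge_min; apply/orP.
  have := normr_ge0 (abscissa p - abscissa q); have := normr_ge0 (abscissa q - abscissa r).
  case: (leP (_ + _) (_ + Fpq)) => ?; case: (leP (_ + _) (_ + Fqr)) => ? ? ?.
  - by left; lra.
  - by right; lra.
  - by right; lra.
  - by right; lra.
Qed.

(** Total in [y] for convenience: the value 1 replaces heights that are not
    positive. *)
Definition half_point (x y : R) : H.
Proof.
exists (x, if 0 < y then y else 1 : R).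
by apply: mem_set; rewrite /half_plane /=; case: ifP.
Defined.

Lemma abscissa_half_point x y : abscissa (half_point x y) = x.
Proof. by []. Qed.

Lemma height_half_point x y : 0 < y -> height (half_point x y) = y.
Proof. by rewrite /height /= => ->. Qed.

Lemma half_pointK p : half_point (abscissa p) (height p) = p.
Proof.
apply: val_inj => /=; rewrite half_plane_gt0.
by rewrite -surjective_pairing.
Qed.

Lemma joinable_segment (rho : H * H -> R) (x y x' y' M : R) : 0 < y -> 0 < y' ->
  (forall s t, 0 <= s -> s <= t -> t <= 1 ->
    rho (half_point (x + s * (x' - x)) (y + s * (y' - y)),
         half_point (x + t * (x' - x)) (y + t * (y' - y))) <= M * t - M * s) ->
  joinable rho (half_point x y) (half_point x' y') M.
Proof.
move=> y0 y'0 le.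
exists (fun t => half_point (x + t * (x' - x)) (y + t * (y' - y))), ( *%R M), M.
split => //.
- by rewrite !mul0r !addr0.
- by congr half_point; ring.
- by rewrite mulr1 mulr0 subr0.
Qed.

Lemma segment_gt0 (y y' t : R) : 0 < y -> 0 < y' -> 0 <= t -> t <= 1 ->
  0 < y + t * (y' - y).
Proof.
move=> y0 y'0 t0 t1; have -> : y + t * (y' - y) = (1 - t) * y + t * y' by ring.
have [->|t_neq0] := eqVneq t 0; first by rewrite subr0 mul1r mul0r addr0.
apply: ltr_wpDl; first by rewrite mulr_ge0 ?subr_ge0// ltW.
by rewrite mulr_gt0// lt_neqAle eq_sym t_neq0.
Qed.

Lemma segment_norm (x x' s t : R) : s <= t ->
  `|(x + s * (x' - x)) - (x + t * (x' - x))| = (t - s) * `|x - x'|.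
Proof.
move=> st; rewrite (_ : _ - _ = (t - s) * (x - x')); last by ring.
by rewrite normrM ger0_norm ?subr_ge0.
Qed.

Lemma joinable_direct (rho : H * H -> R) p q :
  (forall pq, rho pq <= direct pq) -> joinable rho p q (direct (p, q)).
Proof.
move=> le; rewrite -{1}[p]half_pointK -{1}[q]half_pointK.
apply: joinable_segment => [||s t s0 st t1]; try exact: half_plane_gt0.
apply: le_trans (le _) _; rewrite /direct !abscissa_half_point !height_half_point /=; first last.
- by apply: segment_gt0; rewrite ?half_plane_gt0// (le_trans st).
- by apply: segment_gt0; rewrite ?half_plane_gt0// (le_trans s0).
rewrite !segment_norm// le_eqVlt; apply/orP; left; apply/eqP; ring.
Qed.

Lemma joinable_vertical h (x y y' : R) : 0 < y -> 0 < y' ->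
  joinable (short h) (half_point x y) (half_point x y') `|y - y'|.
Proof.
move=> y0 y'0; apply: joinableW (joinable_direct _ _ (short_le_direct h)).
by rewrite /direct !abscissa_half_point !height_half_point//= subrr normr0 mulr0 add0r.
Qed.

Lemma joinable_horizontal h (x x' c : R) : 0 < c -> c <= h ->
  joinable (short h) (half_point x c) (half_point x' c) `|x - x'|.
Proof.
move=> c0 ch; apply: joinable_segment => // s t s0 st t1.
rewrite subrr !mulr0 addr0 /short ge_min; apply/orP; right.
rewrite /detour !abscissa_half_point !height_half_point//= subrr normr0.
rewrite segment_norm// max_l; last by lra.
by rewrite addr0 mulrBl ![_ * `|_|]mulrC.
Qed.

(** Descend to height [c], the strip or the lower of the two points if that one is
    in the strip already; then go across and up. *)
Lemma joinable_detour h p q : 0 < h -> joinable (short h) p q (detour h (p, q)).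
Proof.
move=> h0; pose c := Num.min h (Num.min (height p) (height q)).
have p0 := half_plane_gt0 p; have q0 := half_plane_gt0 q.
have c0 : 0 < c by rewrite !lt_min h0 p0 q0.
have ch : c <= h by rewrite ge_min lexx.
have cp : c <= height p by rewrite !ge_min lexx !orbT.
have cq : c <= height q by rewrite !ge_min lexx !orbT.
pose x (i : nat) := nth q [:: p; half_point (abscissa p) c; half_point (abscissa q) c] i.
pose M (i : nat) := nth 0 [:: `|height p - c|; `|abscissa p - abscissa q|; `|c - height q|] i.
have := @joinable_sum _ _ (short h) x M 3 (short_distance h) isT.
rewrite !big_ord_recl big_ord0 /x /M /= addr0 => join; apply: joinableW (join _).
  rewrite /detour /=.
  have -> : `|height p - c| = height p - c by rewrite ger0_norm// subr_ge0.
  have -> : `|c - height q| = height q - c by rewrite ler0_norm ?opprB// subr_le0.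
  have : height p - c + (height q - c) <=
      Num.max `|height p - height q| (height p + height q - 2 * h).
    rewrite le_max /c; apply/orP.
    case: (leP (height p) (height q)) => pq.
      case: (leP h (height p)) => hp; [right; lra|left].
      by rewrite ler0_norm; lra.
    case: (leP h (height q)) => hq; [right; lra|left].
    by rewrite ger0_norm; lra.
  by lra.
case=> [|[|[|]]]//= _.
- by rewrite -{1}[p]half_pointK; exact: joinable_vertical.
- exact: joinable_horizontal.
- by rewrite -{2}[q]half_pointK; exact: joinable_vertical.
Qed.

Lemma joinable_short h p q : 0 < h -> joinable (short h) p q (short h (p, q)).
Proof.
move=> h0; rewrite {2}/short; case: leP => _; last exact: joinable_detour.
by apply: joinable_direct; exact: short_le_direct.
Qed.

Lemma direct_Dclass : Dclass 3 H direct.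
Proof.
split=> [|pq].
  apply: joinable_length_space direct_distance _ => p q e e0.
  by apply: joinableW (joinable_direct _ _ (fun pq => lexx _)); rewrite lerDl ltW.
rewrite direct_le_dist andbT; apply: le_trans (dist_le_direct pq).
rewrite ler_pdivrMl//; have : 0 <= restr_mdist pq := mdist_ge0 _ _.
by lra.
Qed.

Lemma short_Dclass h : 0 < h -> Dclass 3 H (short h).
Proof.
move=> h0; split=> [|pq].
  apply: joinable_length_space (short_distance h) _ => p q e e0.
  by apply: joinableW (joinable_short _ _ h0); rewrite lerDl ltW.
apply/andP; split; last exact: le_trans (short_le_direct _ _) (direct_le_dist pq).
apply: le_trans (dist_le_short h pq).
rewrite ler_pdivrMl//; have : 0 <= restr_mdist pq := mdist_ge0 _ _.
by lra.
Qed.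

End Shortcut.

(** * Gamma-convergence without convergence *)

Section Counterexample.
Context {R : realType}.
Local Notation H := (@half_plane R).

(** The height attains its minimum along the curve. *)
Lemma lipschitz_height_bound (g : `[0 : R, 1]%classic -> H) :
  lipschitz_curve (@restr_mdist R (plane R) H) g ->
  exists2 b, 0 < b & forall t, b <= height (g t).
Proof.
move=> [K lip]; pose f (t : R) := height (g (unit_clamp t)).
have cf : continuous f.
  pose K' := Num.max K 1.
  have K'0 : 0 < K' by rewrite lt_max ltr01 orbT.
  move=> s; apply/cvgrPdist_le => e e0.
  near=> t.
  have : `|f s - f t| <= K' * `|s - t|.
    apply: le_trans (_ : restr_mdist (g (unit_clamp s), g (unit_clamp t)) <= _).
      by rewrite half_mdistE le_max lexx orbT.
    apply: le_trans (lip _ _) _.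
    apply: le_trans (_ : K' * `|\val (unit_clamp s) - \val (unit_clamp t)| <= _).
      by rewrite ler_wpM2r// le_max lexx.
    by rewrite ler_pM2l// unit_clamp_lipschitz.
  move/le_trans; apply; rewrite mulrC -ler_pdivlMr//.
  by near: t; apply: cvgr_dist_le; [exact: cvg_id|rewrite divr_gt0].
have [c _ minf] := EVT_min ler01 (continuous_subspaceT cf).
exists (f c); first exact: half_plane_gt0.
move=> t; rewrite -(unit_clampK t); apply: minf.
by rewrite in_itv /=; apply/andP; exact: unitP.
Unshelve. all: by end_near. Qed.

(** Along a curve above the strip the two distances agree at small scale, hence an
    arc-length function for [short h] is one for [direct], by
    [controlled_local]. *)
Lemma length_direct_le_short (b h : R) (g : `[0 : R, 1]%classic -> H) :
  0 < b -> h <= b -> (forall t, 2 * b <= height (g t)) ->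
  lipschitz_curve (@restr_mdist R (plane R) H) g ->
  (curve_length direct g <= curve_length (short h) g)%E.
Proof.
move=> b0 hb gb [K lip].
have len0 := curve_length_ge0 g (short_distance h).
case len_g : (curve_length (short h) g) len0 => [M| |]// _; last by rewrite leey.
have [|phi ctl le] := @length_controlled _ _ (short h) g M (short_distance h).
  by rewrite len_g.
apply: le_trans (_ : _ <= (phi 1 - phi 0)%:E)%E _; last by rewrite lee_fin.
apply: curve_length_le direct_distance _.
pose K' := Num.max K 1.
have K'0 : 0 < K' by rewrite lt_max ltr01 orbT.
(* At this scale [direct <= 3 * K' * (t - s) <= 2 * b], while heights add up to
   at least [4 * b] and [2 * h <= 2 * b]. *)
apply: (@controlled_local _ _ _ _ _ (2 * b / (3 * K')) direct_distance).
  by rewrite !divr_gt0 ?mulr_gt0.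
move=> s t s0 st t1 small; rewrite -(@short_eq_direct _ h); first exact: ctl.
apply: le_trans (direct_le_dist _) _.
apply: le_trans (_ : 3 * (K' * (t - s)) <= _).
  rewrite ler_pM2l//; apply: le_trans (lip _ _) _.
  rewrite !unit_clampE ?(le_trans s0)// ?(le_trans st)//.
  rewrite distrC ger0_norm ?subr_ge0//.
  by rewrite ler_wpM2r ?subr_ge0// le_max lexx.
apply: le_trans (_ : 2 * b <= _).
  by move: small; rewrite ler_pdivlMr ?mulr_gt0// => small; lra.
by have := gb (unit_clamp s); have := gb (unit_clamp t); rewrite /=; lra.
Qed.

Definition direct_dist : Dclass 3 H := exist _ direct (mem_set direct_Dclass).

Lemma invS_gt0 n : 0 < n.+1%:R^-1 :> R.
Proof. by rewrite invr_gt0. Qed.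

Definition short_dist (n : nat) : Dclass 3 H :=
  exist _ (short n.+1%:R^-1) (mem_set (short_Dclass (invS_gt0 n))).

(** Constant sequences are recovery sequences because [short h <= direct].  For the
    lower bound, the curves [g_ n] eventually stay above the strip, which reduces
    the claim to the lower semicontinuity of the length for [direct]. *)
Lemma gamma_cvg_short :
  gamma_cvg (fun n => Lip_length (short_dist n)) (Lip_length direct_dist).
Proof.
have alpha1 : 1 < 3 :> R by rewrite ltr1n.
move=> g; split=> [g_ cvg|].
  apply: le_trans (length_liminf alpha1 (d_ := fun=> direct_dist) (fun=> cvg_cst _) cvg) _.
  apply: le_limn_einf.
  have [b b0 gb] := lipschitz_height_bound (set_valP g).
  move/Lip01_cvgP : cvg => cvg.
  have b4 : 0 < b / 4 by rewrite divr_gt0.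
  near=> n; apply: (@length_direct_le_short (b / 4)) => //.
  - by apply: ltW; near: n; exact: (near_infty_natSinv_lt (PosNum b4)).
  - move=> t.
    have : restr_mdist (\val (g_ n) t, \val g t) < b / 4 by move: t; near: n; exact: cvg.
    rewrite half_mdistE gt_max => /andP[_]; rewrite distrC.
    have := ler_norm (height (\val g t) - height (\val (g_ n) t)).
    by have := gb t; lra.
  - exact: set_valP (g_ n).
exists (fun=> g); first exact: cvg_cst.
apply: limn_esup_le; apply: nearW => n; apply: le_curve_length => pq.
exact: short_le_direct.
Unshelve. all: by end_near. Qed.

(** Between the points (0, 1) and (3, 1), the direct route costs 6 and the detour
    less than 5. *)
Lemma short_not_cvg : ~ (short_dist @ \oo --> direct_dist).
Proof.
move=> /Dclass_cvg_pointwise/(_ (half_point 0 1, half_point 3 1)).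
move/cvgrPdist_lt => /(_ 1 ltr01) [N _ /(_ N (leqnn N))] /=.
have -> : direct (half_point 0 1, half_point 3 1) = 6 :> R.
  rewrite /direct /= !abscissa_half_point !height_half_point// subrr normr0 sub0r normrN.
  by rewrite ger0_norm//; lra.
suff : short N.+1%:R^-1 (half_point 0 1, half_point 3 1) <= 5 :> R.
  by rewrite ltr_norml => le5 /andP[_]; lra.
rewrite ge_min; apply/orP; right.
rewrite /detour /= !abscissa_half_point !height_half_point// subrr normr0 sub0r normrN.
rewrite ger0_norm//.
have := invS_gt0 N; set h := N.+1%:R^-1 => h0.
have : Num.max 0 (1 + 1 - 2 * h) <= 2.
  by rewrite ge_max; apply/andP; split; lra.
by lra.
Qed.

End Counterexample.

Theorem proposition4p4 (R : realType) :
  (forall (X : metricType R) (alpha : R) (Omega : set X),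
      locally_compact [set: X] -> complete_space X -> 1 < alpha -> open Omega ->
      Dclass alpha Omega !=set0 ->
      forall (d_ : nat -> Dclass alpha Omega) (d : Dclass alpha Omega),
        d_ @ \oo --> d ->
        gamma_cvg (fun n => Lip_length (d_ n)) (Lip_length d))
  /\
  (exists (X : metricType R) (alpha : R) (Omega : set X),
      [/\ locally_compact [set: X], complete_space X, 1 < alpha &
        [/\ open Omega, Dclass alpha Omega !=set0 &
           exists (d_ : nat -> Dclass alpha Omega) (d : Dclass alpha Omega),
            gamma_cvg (fun n => Lip_length (d_ n)) (Lip_length d) /\
            ~ (d_ @ \oo --> d)]]).
Proof.
split=> [X alpha Omega _ _ alpha1 _ _ d_ d /Dclass_cvg_pointwise cvd|].
  exact: gamma_cvg_of_pointwise.
exists (plane R), 3, half_plane; split.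
- exact: locally_compact_plane.
- exact: complete_plane.
- by rewrite ltr1n.
- split; [exact: open_half_plane | by exists direct; exact: direct_Dclass|].
  exists short_dist, direct_dist; split; [exact: gamma_cvg_short|exact: short_not_cvg].
Qed.
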